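(* Let $p\in[0,1)$ and $\lambda\geq0$, let $\mu_{p,\lambda}$ be the measure on $[0,+\infty)$ given by $d\mu_{p,\lambda}(t)=t^{-p}e^{-\lambda t}\,dt$, and let $\Phi_{p,\lambda}(t)=\mu_{p,\lambda}([0,t])$ be its distribution function. Let $N:[0,+\infty)\to[0,+\infty)$ be increasing and convex. Let $f:[0,+\infty)\to[0,+\infty)$ be a decreasing, log-concave function, integrable with respect to $\mu_{p,\lambda}$, with $V:=\int_0^{+\infty}f\,d\mu_{p,\lambda}>0$. If $h>0$ is such that $u:=\int_0^hf\,d\mu_{p,\lambda}$ satisfies $$u\leq\frac12V,$$ then $$\int_0^{+\infty}N(t)f(t)\,d\mu_{p,\lambda}(t)\geq\frac{u}{\Phi_{p,\lambda}(h)}\int_0^{\Phi_{p,\lambda}^{-1}\left(\frac Vu\Phi_{p,\lambda}(h)\right)}N(t)\,d\mu_{p,\lambda}(t).$$ Equality holds for $f(t)=c\chi_{[0,d]}(t)$ with $c,d>0$.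
   Context: ''Increasing'' and ''decreasing'' are meant in the non-strict sense. A function $f:[0,+\infty)\to[0,+\infty)$ is log-concave if $f((1-\tau)x+\tau y)\geq f(x)^{1-\tau}f(y)^{\tau}$ for all $x,y\geq 0$ and $\tau\in(0,1)$. $\chi_A$ denotes the indicator function of $A$. $\Phi_{p,\lambda}^{-1}$ is the inverse of the strictly increasing function $\Phi_{p,\lambda}$, with the convention that its value at $\mu_{p,\lambda}([0,+\infty))$ is $+\infty$ when this total mass is finite. Integrals of $N$ may equal $+\infty$. *)

(* Defs.v *)
From HB Require Import structures.
From mathcomp Require Import all_boot all_order all_algebra.
From mathcomp Require Import all_classical all_reals all_analysis.
From mathcomp Require Import measurable_realfun.

Set Implicit Arguments.
Unset Strict Implicit.
Unset Printing Implicit Defensive.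

Import Order.TTheory GRing.Theory Num.Theory.
Import numFieldNormedType.Exports.

Local Open Scope classical_set_scope.
Local Open Scope ring_scope.

(* A function on [0, +oo[ is represented by a total function [R -> R], and only
   its values on [`[0, +oo[] are ever constrained or used. *)

Section mu.
Context {R : realType}.
Variables p lambda : R.

(* At 0 [powR] gives [0 `^ (- p) = 0] for [p != 0]; {0} is a null set. *)
Definition mu_density : R -> R :=
  (fun t => t `^ (- p) * expR (- lambda * t)) \_ `[0, +oo[.

(* The measure t^-p e^(-lambda t) dt, as a measure on R carried by [0, +oo[. *)
Definition mu_pl (A : set R) : \bar R :=
  (\int[lebesgue_measure]_(t in A) (mu_density t)%:E)%E.

Lemma mu_density_ge0 t : 0 <= mu_density t.
Proof.
rewrite /mu_density patchE; case: ifPn => // _.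
by rewrite mulr_ge0 ?powR_ge0 ?expR_ge0.
Qed.

Lemma measurable_mu_density : measurable_fun [set: R] mu_density.
Proof.
apply/measurable_restrict => //; apply: measurable_funTS.
apply: measurable_funM; first exact: measurable_powR.
by apply: measurableT_comp => //; exact: measurable_funM.
Qed.

Let mu_pl0 : mu_pl set0 = 0%E.
Proof. by rewrite /mu_pl integral_set0. Qed.

Let mu_pl_ge0 A : (0 <= mu_pl A)%E.
Proof. by apply: integral_ge0 => t _; rewrite lee_fin mu_density_ge0. Qed.

Let mu_pl_sigma_additive : semi_sigma_additive mu_pl.
Proof.
move=> /= F mF tF mUF; rewrite /mu_pl; apply: cvg_toP.
  apply: ereal_nondecreasing_is_cvgn => m n mn.
  apply: lee_sum_nneg_natr => // k _ _; exact: mu_pl_ge0.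
rewrite ge0_integral_bigcup//=.
- apply/measurable_funTS/measurableT_comp => //.
  exact: measurable_mu_density.
- by move=> x _; rewrite lee_fin mu_density_ge0.
Qed.

HB.instance Definition _ := isMeasure.Build _ _ _
  mu_pl mu_pl0 mu_pl_ge0 mu_pl_sigma_additive.

(* [fine] loses nothing when [p < 1], since [mu_pl `[0, t]] is then finite. *)
Definition Phi (t : R) : R := fine (mu_pl `[0, t]).

Definition Phi_inv (v : R) : \bar R :=
  if v%:E == mu_pl `[0, +oo[ then +oo%E
  else ('pinv_(fun=> 0) `[0, +oo[ Phi v)%:E.

End mu.

Definition log_concave {R : realType} (f : R -> R) :=
  forall x y tau : R, 0 <= x -> 0 <= y -> 0 < tau < 1 ->
    f x `^ (1 - tau) * f y `^ tau <= f ((1 - tau) * x + tau * y).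

(* Main.v *)
From HB Require Import structures.
Require Import Defs.
From mathcomp Require Import all_boot all_order all_algebra.
From mathcomp Require Import all_classical all_reals all_analysis.
From mathcomp Require Import measurable_realfun ring lra.

Import Order.TTheory GRing.Theory Num.Theory.
Import numFieldNormedType.Exports.

Local Open Scope classical_set_scope.
Local Open Scope ring_scope.

(** Write [Phi] for the distribution function, [H = Phi h], [V] for the total
    integral of [f], [u] for its integral over [[0, h]], and [c = u / H] for the
    mean of [f] on [[0, h]]. The right-hand side is the integral of [N * g],
    where [g] is [c] times the indicator of [[0, d]] and [Phi d = V H / u], so
    that [f] and [g] have the same integral over [[0, h]] and over the half-line.

    Subtracting from [N] a combination of [1] and of the indicator of [[0, h]]
    therefore changes both sides by the same amount. Take
    [w = N - N d + beta * indicator of [0, h]], with [beta] such that [w] has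
    integral 0 over [[0, d]]. Since [N] increases, [w <= 0] on [(h, d]] and
    [w >= 0] beyond [d]; if also [w >= 0] on [[0, h]], then [w * f] dominates
    [w * f h * indicator of [0, d]] pointwise because [f] decreases, and the
    integral of the latter vanishes. This is [balanced_weight_integral_ge], and
    it gives the inequality.

    What remains is the sign of [w] on [[0, h]], that is
    [(N d - N 0) * H <= N d * Phi d - integral of N over [0, d]]. The chord bound
    for the convex function [N], together with the fact that the barycentre of
    [[0, d]] lies to the left of [d / 2] (the density decreases:
    [integral_centered_le0]), bounds the mean of [N] over [[0, d]] by
    [(N 0 + N d) / 2] ([integral_convex_le]). The right-hand side is thus at
    least [(N d - N 0) * Phi d / 2], and [u <= V / 2] says exactly that
    [2 * H <= Phi d].

    Such a [d] exists because [Phi] is continuous and [V H / u] is at most the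
    total mass: the mean of a decreasing function over [[0, h]] is at least its
    mean over the half-line ([integral_le_mean_tail]). When [V H / u] is the
    total mass, the same estimate forces [f >= c] everywhere, and the inequality
    is immediate. *)

(** * Comparison of integrals for two measures *)

(** The comparison of measures is only needed on subsets of [D]: restricting
    both measures to [D] reduces the claim to a global comparison. *)
Lemma ge0_le_measure_integral_in d (T : measurableType d) (R : realType)
    (m1 m2 : {measure set T -> \bar R}) (D : set T) (f : T -> \bar R) :
  measurable D ->
  (forall A, measurable A -> A `<=` D -> (m1 A <= m2 A)%E) ->
  (forall x, D x -> (0 <= f x)%E) -> measurable_fun D f ->
  (\int[m1]_(x in D) f x <= \int[m2]_(x in D) f x)%E.
Proof.
move=> mD m12 f0 mf.
have restrE (m : {measure set T -> \bar R}) :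
    (\int[m]_(x in D) f x = \int[mrestr m mD]_(x in D) (f \_ D) x)%E.
  rewrite (@eq_measure_integral _ _ _ _ (mrestr m mD)).
    by apply: eq_integral => x xD; rewrite patchE xD.
  by move=> A mA AD; rewrite /= /mrestr setIidl.
rewrite !restrE; apply: ge0_le_measure_integral => //.
- move=> S mS; apply: m12; [exact: measurableI|exact: subIsetr].
- by move=> x; apply: erestrict_ge0.
- exact/(measurable_restrictT _ _).1.
Qed.

Section scaled_measure_comparison.
Context d (T : measurableType d) (R : realType).
Variables (m1 m2 : {measure set T -> \bar R}) (k : R) (D : set T).
Variable f : T -> \bar R.
Hypotheses (k_ge0 : 0 <= k) (mD : measurable D).
Hypothesis f_ge0 : forall x, D x -> (0 <= f x)%E.
Hypothesis mf : measurable_fun D f.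

Lemma ge0_integral_le_scale :
  (forall A, measurable A -> A `<=` D -> (m1 A <= k%:E * m2 A)%E) ->
  (\int[m1]_(x in D) f x <= k%:E * \int[m2]_(x in D) f x)%E.
Proof.
move=> m12; rewrite -[k]/((NngNum k_ge0)%:num) -ge0_integral_mscale//.
exact: ge0_le_measure_integral_in.
Qed.

Lemma ge0_integral_ge_scale :
  (forall A, measurable A -> A `<=` D -> (k%:E * m2 A <= m1 A)%E) ->
  (k%:E * \int[m2]_(x in D) f x <= \int[m1]_(x in D) f x)%E.
Proof.
move=> m21; rewrite -[k]/((NngNum k_ge0)%:num) -ge0_integral_mscale//.
exact: ge0_le_measure_integral_in.
Qed.

End scaled_measure_comparison.

(** * Lebesgue measure on the Borel structure of the reals *)

Section lebesgue_on.
Context {R : realType}.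
Local Notation leb := (@lebesgue_measure R).

(** [mu_pl] is a measure for the Borel structure carried by [R] itself, whereas
    [lebesgue_measure] is one for the copy [measurableTypeR R]. The measurable
    sets are the same, but comparing the two measures needs a common type. *)
Definition lebesgue_on (A : set R) : \bar R := leb A.

Let lebesgue_on0 : lebesgue_on set0 = 0%E.
Proof. exact: measure0. Qed.

Let lebesgue_on_ge0 A : (0 <= lebesgue_on A)%E.
Proof. exact: measure_ge0. Qed.

Let lebesgue_on_sigma_additive : semi_sigma_additive lebesgue_on.
Proof. exact: (@measure_semi_sigma_additive _ _ _ leb). Qed.

HB.instance Definition _ := isMeasure.Build _ _ _ lebesgue_on
  lebesgue_on0 lebesgue_on_ge0 lebesgue_on_sigma_additive.

Lemma ge0_integral_lebesgue_on (D : set R) (f : R -> \bar R) :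
  measurable D -> measurable_fun D f -> (forall x, D x -> (0 <= f x)%E) ->
  (\int[lebesgue_on]_(x in D) f x = \int[leb]_(x in D) f x)%E.
Proof.
move=> mD mf f0.
apply: (@ge0_integral_pushforward _ _ (measurableTypeR R) R R idfun) => //.
  exact: measurable_id.
by move=> x; rewrite inE; exact: f0.
Qed.

End lebesgue_on.

(** * Integrals of affine and of monotone functions *)

Lemma derivable_oo_LRcontinuousW (R : realType) (F : R -> R) (a b : R) :
  a < b -> (forall x, a <= x -> derivable F x 1) ->
  derivable_oo_LRcontinuous F a b.
Proof.
move=> ab dF.
have cF x : a <= x -> {for x, continuous F}.
  by move=> ax; apply/differentiable_continuous/derivable1_diffP/dF.
split.
- by move=> x /[!in_itv]/= /andP[/ltW ax _]; exact: dF.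
- by apply: cvg_at_right_filter; apply: cF.
- by apply: cvg_at_left_filter; apply: cF; exact: ltW.
Qed.

Lemma integral_affine (R : realType) (k c a b : R) : a < b ->
  (\int[lebesgue_measure]_(t in `[a, b]) (k * (t - c))%:E =
   (k * ((b - c) ^+ 2 - (a - c) ^+ 2) / 2)%:E)%E.
Proof.
move=> ab; pose F (t : R) := k / 2 * (t - c) ^+ 2.
have dF (x : R) : is_derive x 1 F (k * (x - c)).
  rewrite /F; apply: is_derive_eq.
  by rewrite /GRing.scale/=; field.
rewrite (@continuous_FTC2 _ _ F) //.
- by rewrite -EFinB /F; congr (_%:E); field.
- by apply: derivable_within_continuous => x _.
- exact: derivable_oo_LRcontinuousW.
- by move=> x _; rewrite derive1E derive_val.
Qed.

Lemma integrable_le_cst d (T : measurableType d) (R : realType)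
    (mu : {measure set T -> \bar R}) (A : set T) (g : T -> R) (K : R) :
  measurable A -> (mu A < +oo)%E -> measurable_fun A g ->
  (forall x, A x -> `|g x| <= K) -> mu.-integrable A (EFin \o g).
Proof.
move=> mA muA mg gK; apply: measurable_bounded_integrable => //.
exists K; split => [|M KM x Ax]; first exact: num_real.
exact: le_trans (gK _ Ax) (ltW KM).
Qed.

Lemma measurable_fun_homo_itvcy (R : realType) (g : R -> R) :
  {in `[0, +oo[ &, {homo g : x y / x <= y}} ->
  measurable_fun (`[0, +oo[ : set R) g.
Proof.
move=> g_homo.
apply: (eq_measurable_fun (g \o Num.max 0)).
  by move=> x; rewrite inE/= in_itv/= andbT => x0; rewrite max_r.
apply: nondecreasing_measurable => // x y xy.
apply: g_homo; rewrite ?in_itv/= ?andbT.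
- by rewrite le_max lexx.
- by rewrite le_max lexx.
- by rewrite ge_max !le_max lexx xy orbT.
Qed.

Lemma integrable_homo_itv (R : realType) (mu : {measure set R -> \bar R})
    (g : R -> R) (d : R) :
  0 <= d -> (mu `[0%R, d]%classic < +oo)%E ->
  {in `[0, +oo[, forall t, 0 <= g t} ->
  {in `[0, +oo[ &, {homo g : x y / x <= y}} ->
  mu.-integrable `[0, d] (EFin \o g).
Proof.
move=> d0 mud g_ge0 g_homo.
apply: (@integrable_le_cst _ _ _ _ _ _ (g d)) => //.
  apply: measurable_funS (measurable_fun_homo_itvcy _ _ g_homo) => //.
  by move=> x /=; rewrite !in_itv/= andbT => /andP[].
move=> x /=; rewrite in_itv/= => /andP[x0 xd].
by rewrite ger0_norm ?g_ge0 ?g_homo ?in_itv/= ?andbT.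
Qed.

(** * Sign changes of the weight against a decreasing function *)

Section crossing.
Context {R : realType} (mu : {measure set R -> \bar R}).
Variables (f N : R -> R) (h d beta : R).
Hypotheses (h_ge0 : 0 <= h) (hd : h <= d).
Hypothesis f_ge0 : {in `[0, +oo[, forall t, 0 <= f t}.
Hypothesis f_decr : {in `[0, +oo[ &, {homo f : x y /~ x <= y}}.
Hypothesis N_ge0 : {in `[0, +oo[, forall t, 0 <= N t}.
Hypothesis N_incr : {in `[0, +oo[ &, {homo N : x y / x <= y}}.
Hypothesis mud : (mu `[0%R, d]%classic < +oo)%E.
Hypothesis f_int : mu.-integrable `[0, +oo[ (EFin \o f).
Hypothesis Nf_int : mu.-integrable `[0, +oo[ (EFin \o (fun t => N t * f t)).
Hypothesis N0d : N d <= N 0 + beta.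
Hypothesis balance : beta * fine (mu `[0, h]%classic) =
  N d * fine (mu `[0, d]%classic) - \int[mu]_(t in `[0, d]) N t.

(** [balance] makes the weight [N - N d + beta * indicator of [0, h]] integrate
    to 0 over [[0, d]], and [N0d] makes it nonnegative on [[0, h]]. Against a
    decreasing [f] it therefore has a nonnegative integral: the comparison is
    with the constant [f h] on [[0, d]]. *)
Lemma balanced_weight_integral_ge :
  N d * \int[mu]_(t in `[0, +oo[) f t - beta * \int[mu]_(t in `[0, h]) f t
  <= \int[mu]_(t in `[0, +oo[) (N t * f t).
Proof.
have d0 := le_trans h_ge0 hd.
have I_d : `[0, d] `<=` (`[0, +oo[ : set R).
  by move=> x /=; rewrite !in_itv/= andbT => /andP[].
have I_h : `[0, h] `<=` (`[0, +oo[ : set R).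
  by move=> x /=; rewrite !in_itv/= andbT => /andP[].
have muh : (mu `[0%R, h]%classic < +oo)%E.
  apply: le_lt_trans mud; apply: le_measure; rewrite ?inE// => x /=.
  by rewrite !in_itv/= => /andP[-> /le_trans->].
have c_int (c b : R) : (mu `[0%R, b]%classic < +oo)%E ->
    mu.-integrable `[0, b] (EFin \o cst c).
  by move=> b_fin; apply: (@integrable_le_cst _ _ _ _ _ _ `|c|).
have fh_int : mu.-integrable `[0, h] (EFin \o f).
  exact: integrableS f_int.
have Nd_int : mu.-integrable `[0, d] (EFin \o N) by exact: integrable_homo_itv.
pose k := f h.
pose G1 := fun t => k * (N t - N d).
pose G2 := fun t => beta * (k - f t).
have NB_int : mu.-integrable `[0, d] (EFin \o (fun t => N t - N d)).
  by apply: (@integrableB _ _ _ _ _ _ (EFin \o N) (EFin \o cst (N d))) => //;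
    exact: c_int.
have kf_int : mu.-integrable `[0, h] (EFin \o (fun t => k - f t)).
  by apply: (@integrableB _ _ _ _ _ _ (EFin \o cst k) (EFin \o f)) => //;
    exact: c_int.
have G1_int : mu.-integrable `[0, d] (EFin \o G1).
  by apply: (@integrableZl _ _ _ _ _ _ k (EFin \o (fun t => N t - N d))).
have G2_int : mu.-integrable `[0, h] (EFin \o G2).
  by apply: (@integrableZl _ _ _ _ _ _ beta (EFin \o (fun t => k - f t))).
have G1r_int : mu.-integrable `[0, +oo[ (EFin \o (G1 \_ `[0, d])).
  by rewrite -restrict_EFin; apply/integrable_restrict => //; rewrite setIidr.
have G2r_int : mu.-integrable `[0, +oo[ (EFin \o (G2 \_ `[0, h])).
  by rewrite -restrict_EFin; apply/integrable_restrict => //; rewrite setIidr.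
have Ndf_int : mu.-integrable `[0, +oo[ (EFin \o (fun t => N d * f t)).
  by apply: (@integrableZl _ _ _ _ _ _ (N d) (EFin \o f)).
have G12_int : mu.-integrable `[0, +oo[
    (EFin \o (fun t => (G1 \_ `[0, d]) t + (G2 \_ `[0, h]) t)).
  exact: (@integrableD _ _ _ _ _ _ (EFin \o (G1 \_ `[0, d]))
    (EFin \o (G2 \_ `[0, h]))).
(* [N * f] exceeds the left integrand by [(f - f h)] times the weight on
   [[0, d]], a product of factors of the same sign, and by [f * (N - N d)]
   beyond [d]. *)
have : \int[mu]_(t in `[0, +oo[)
    ((G1 \_ `[0, d]) t + (G2 \_ `[0, h]) t + N d * f t)
    <= \int[mu]_(t in `[0, +oo[) (N t * f t).
  apply: le_Rintegral => //.
    exact: (@integrableD _ _ _ _ _ _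
      (EFin \o (fun t => (G1 \_ `[0, d]) t + (G2 \_ `[0, h]) t))
      (EFin \o (fun t => N d * f t))).
  move=> t; rewrite /= in_itv/= andbT => t0.
  have ft0 : 0 <= f t by rewrite f_ge0// in_itv/= t0.
  rewrite !patchE !mem_setE !in_itv/= t0/= /G1 /G2 /k (_ : point = 0 :> R)//.
  have [th|ht] := leP t h.
    rewrite (le_trans th hd).
    have fht : f h <= f t by rewrite f_decr ?in_itv/= ?t0 ?h_ge0.
    have N0t : N 0 <= N t by rewrite N_incr ?in_itv/= ?t0 ?lexx.
    have Ndt : 0 <= N t + beta - N d.
      by rewrite subr_ge0 (le_trans N0d)// lerD2r.
    have := mulr_ge0 _ Ndt; rewrite -(subr_ge0 (f h)) in fht => /(_ _ fht).
    move=> ?; lra.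
  have [td|dt] := leP t d.
    have ftk : f t <= f h by rewrite f_decr ?in_itv/= ?t0 ?h_ge0// ltW.
    have Ntd : N t <= N d by rewrite N_incr ?in_itv/= ?t0 ?d0.
    rewrite -subr_ge0 in ftk; rewrite -subr_ge0 in Ntd.
    have := mulr_ge0 ftk Ntd; lra.
  have Ndt : N d <= N t by rewrite N_incr ?in_itv/= ?t0 ?d0// ltW.
  by rewrite !add0r ler_wpM2r.
have G1E : \int[mu]_(t in `[0, d]) G1 t =
    k * (\int[mu]_(t in `[0, d]) N t - N d * fine (mu `[0, d]%classic)).
  rewrite RintegralZl//.
  by rewrite RintegralB ?Rintegral_cst//; exact: c_int.
have G2E : \int[mu]_(t in `[0, h]) G2 t =
    beta * (k * fine (mu `[0, h]%classic) - \int[mu]_(t in `[0, h]) f t).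
  rewrite RintegralZl//.
  by rewrite RintegralB ?Rintegral_cst//; exact: c_int.
rewrite RintegralD// RintegralD// -!Rintegral_mkcondr !setIidr// G1E G2E.
rewrite RintegralZl//.
rewrite [beta * (_ - _)]mulrBr [beta * (k * _)]mulrCA balance; lra.
Qed.
End crossing.

(** * Chords of convex functions and means of decreasing functions *)

Lemma convex_le_chord (R : realType) (N : R -> R) (d t : R) :
  convex_function (`[0, +oo[ : set R^o) N -> 0 < d -> 0 <= t <= d ->
  N t <= N 0 + (N d - N 0) * (t / d).
Proof.
move=> N_convex d0 /andP[t0 td].
have td0 : 0 <= t / d by rewrite divr_ge0// ltW.
have td1 : t / d <= 1 by rewrite ler_pdivrMr// mul1r.
have dI : d \in (`[0, +oo[%classic : set R^o) by rewrite inE/= in_itv/= ltW.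
have oI : 0 \in (`[0, +oo[%classic : set R^o) by rewrite inE/= in_itv/= lexx.
have : N (t / d * d + (1 - t / d) * 0) <= t / d * N d + (1 - t / d) * N 0.
  exact: (N_convex (Itv01 td0 td1) d 0 dI oI).
rewrite mulr0 addr0 divfK ?gt_eqF// => /le_trans; apply.
by rewrite le_eqVlt; apply/orP; left; apply/eqP; ring.
Qed.

Section decreasing_function.
Context {R : realType} (mu : {measure set R -> \bar R}) (f : R -> R).
Hypothesis f_decr : {in `[0, +oo[ &, {homo f : x y /~ x <= y}}.
Hypothesis f_int : mu.-integrable `[0, +oo[ (EFin \o f).

Lemma integral_decr_le (a : R) (B : set R) : 0 <= a -> measurable B ->
  B `<=` `[a, +oo[ -> (mu B < +oo)%E ->
  \int[mu]_(t in B) f t <= f a * fine (mu B).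
Proof.
move=> a0 mB Ba muB; rewrite -Rintegral_cst//; apply: le_Rintegral => //.
- apply: integrableS f_int => // x /Ba/=; rewrite !in_itv/= !andbT.
  exact: le_trans.
- by apply: (@integrable_le_cst _ _ _ _ _ _ `|f a|).
- move=> x /Ba/=; rewrite in_itv/= andbT => ax.
  by rewrite f_decr ?in_itv/= ?andbT// (le_trans a0).
Qed.

Lemma integral_decr_ge (h : R) : 0 <= h -> (mu `[0%R, h]%classic < +oo)%E ->
  f h * fine (mu `[0%R, h]%classic) <= \int[mu]_(t in `[0, h]) f t.
Proof.
move=> h0 muh; rewrite -Rintegral_cst//; apply: le_Rintegral => //.
- by apply: (@integrable_le_cst _ _ _ _ _ _ `|f h|).
- by apply: integrableS f_int => // x /=; rewrite !in_itv/= andbT => /andP[].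
- move=> x /=; rewrite in_itv/= => /andP[x0 xh].
  by rewrite f_decr ?in_itv/= ?andbT.
Qed.
End decreasing_function.

Lemma Rintegral_scaled_indic (R : realType) (mu : {measure set R -> \bar R})
    (c : R) (A D : set R) : 0 <= c -> measurable A -> measurable D ->
  \int[mu]_(t in D) (c * \1_A t) = c * fine (mu (A `&` D)).
Proof.
move=> c0 mA mD; rewrite /Rintegral; under eq_integral do rewrite EFinM.
rewrite ge0_integralZl//; last exact/measurable_EFinP/measurable_indic.
rewrite integral_indic//; have [muoo|mufin] := eqVneq (mu (A `&` D)) +oo%E.
  have [->|c_neq0] := eqVneq c 0; first by rewrite mul0e mul0r.
  by rewrite muoo gt0_muley ?mulr0// lte_fin lt_neqAle eq_sym c_neq0.
by rewrite fineM// ge0_fin_numE// lt_neqAle mufin leey.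
Qed.

(** * The measure and its distribution function *)

Section mu_pl_theory.
Context {R : realType}.
Variables p lambda : R.
Hypotheses (hp0 : 0 <= p) (hp1 : p < 1) (hlambda : 0 <= lambda).
Local Notation mu := (mu_pl p lambda).
Local Notation leb := (@lebesgue_measure R).
Local Notation rho := (mu_density p lambda).
Local Notation Phi := (Phi p lambda).

Lemma mu_densityE t : 0 <= t -> rho t = t `^ (- p) * expR (- lambda * t).
Proof. by move=> t0; rewrite /mu_density patchE mem_set //= in_itv/= t0. Qed.

Lemma mu_density_gt0 t : 0 < t -> 0 < rho t.
Proof.
by move=> t0; rewrite mu_densityE ?ltW// mulr_gt0 ?expR_gt0 ?powR_gt0.
Qed.

Lemma mu_density_decr x y : 0 < x -> x <= y -> rho y <= rho x.
Proof.
move=> x0 xy; have y0 := lt_le_trans x0 xy.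
rewrite !mu_densityE ?(ltW x0) ?(ltW y0)//; apply: ler_pM.
- exact: powR_ge0.
- exact: expR_ge0.
- by rewrite !powRN lef_pV2 ?posrE ?powR_gt0// ge0_ler_powR ?nnegrE ?(ltW x0) ?(ltW y0).
- by rewrite ler_expR !mulNr lerN2 ler_wpM2l.
Qed.

Lemma measurable_EFin_mu_density D : measurable D -> measurable_fun D (EFin \o rho).
Proof.
move=> mD; apply/measurable_EFinP; apply: measurable_funTS.
exact: measurable_mu_density.
Qed.

Lemma mu_plE A : mu A = (\int[leb]_(t in A) (rho t)%:E)%E.
Proof. by []. Qed.

Lemma mu_pl_le_lebesgue (a : R) (A : set R) : 0 < a -> measurable A ->
  A `<=` `[a, +oo[ -> (mu A <= (rho a)%:E * leb A)%E.
Proof.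
move=> a0 mA Aa; rewrite -integral_cst//; apply: ge0_le_integral => //.
- by move=> x _; rewrite lee_fin mu_density_ge0.
- exact: measurable_EFin_mu_density.
- move=> x /Aa/=; rewrite in_itv/= andbT => ax.
  by rewrite lee_fin mu_density_decr.
Qed.

Lemma lebesgue_le_mu_pl (a : R) (A : set R) : measurable A ->
  A `<=` `]0, a] -> ((rho a)%:E * leb A <= mu A)%E.
Proof.
move=> mA Aa; rewrite -integral_cst//; apply: ge0_le_integral => //.
- by move=> x _; rewrite lee_fin mu_density_ge0.
- exact: measurable_EFin_mu_density.
- by move=> x /Aa/=; rewrite in_itv/= => /andP[x0 xa]; rewrite lee_fin mu_density_decr.
Qed.

Lemma mu_pl_set1 x : mu [set x] = 0%E.
Proof. by rewrite mu_plE integral_set1. Qed.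

Lemma integral_powRN_le (a b : R) : 0 < a -> a < b ->
  (\int[leb]_(t in `[a, b]) (t `^ (- p))%:E <=
   (b `^ (1 - p) / (1 - p))%:E)%E.
Proof.
move=> a0 ab; have p1 : 0 < 1 - p by rewrite subr_gt0.
pose F (t : R) := t `^ (1 - p) / (1 - p).
have dF (x : R) : a <= x -> is_derive x 1 F (x `^ (- p)).
  move=> ax; have x0 := lt_le_trans a0 ax.
  have -> : x `^ (- p) = (1 - p)^-1 *: ((1 - p) * x `^ (1 - p - 1)).
    by rewrite /GRing.scale/= mulKf ?gt_eqF//; congr (_ `^ _); ring.
  rewrite (_ : F = (1 - p)^-1 \*: (@powR R ^~ (1 - p))).
    have := is_derive1_powR (1 - p) x0; exact: is_deriveZ.
  by apply/funext => t; rewrite /F mulrC.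
rewrite (@continuous_FTC2 _ _ F) //.
- rewrite -EFinB lee_fin /F gerBl divr_ge0 ?powR_ge0 ?ltW//.
- apply: derivable_within_continuous => x; rewrite in_itv/= => /andP[ax _].
  apply: derivable_powR; rewrite in_itv/= andbT; exact: lt_le_trans ax.
- by apply: derivable_oo_LRcontinuousW => // x /dF [].
- move=> x; rewrite in_itv/= => /andP[/ltW ax _].
  by have [_ <-] := dF _ ax; rewrite derive1E.
Qed.

(** Monotone convergence along [[b / (n + 2), b]], where the integral of
    [t ^ (- p)] is bounded by its primitive [b ^ (1 - p) / (1 - p)] uniformly in
    [n]; this is where [p < 1] matters. *)
Lemma mu_pl_itv_lty (b : R) : (mu `[0%R, b] < +oo)%E.
Proof.
have [b0|b0] := leP b 0.
  apply: (@le_lt_trans _ _ (mu [set 0])); last by rewrite mu_pl_set1.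
  apply: le_measure; rewrite ?inE//.
  by move=> x/=; rewrite in_itv/= => /andP[x0 xb]; apply/eqP; rewrite eq_le x0 (le_trans xb).
have mu0b : mu `[0%R, b] = mu `]0%R, b].
  by rewrite -[LHS](@integral_itv_obnd_cbnd _ 0)//; exact: measurable_EFin_mu_density.
pose F n := [set` `[b / n.+2%:R, b]] : set R.
have bn n : 0 < b / n.+2%:R < b.
  by rewrite divr_gt0//= ltr_pdivrMr// ltr_pMr// ltr1n.
have UF : \bigcup_n F n = `]0, b]%classic.
  apply/seteqP; split=> x /=.
    move=> [n _]; rewrite /F/= !in_itv/= => /andP[nx ->]; rewrite andbT.
    by case/andP: (bn n) => /lt_le_trans /(_ nx).
  rewrite in_itv/= => /andP[x0 xb].
  exists (Num.truncn (b / x)) => //; rewrite /F/= in_itv/= xb andbT.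
  rewrite ler_pdivrMr// mulrC -ler_pdivrMr//.
  have := ltW (truncnS_gt (b / x)); move=> /le_trans; apply.
  by rewrite ler_nat.
have mF n : measurable (F n) by exact: measurable_itv.
have FN : nondecreasing_seq F.
  move=> n m nm; apply/subsetPset => x; rewrite /F/= !in_itv/= => /andP[nx ->].
  rewrite andbT (le_trans _ nx)// ler_pM2l// lef_pV2 ?posrE//.
  by rewrite ler_nat !ltnS.
rewrite mu0b -UF.
apply: (@le_lt_trans _ _ (b `^ (1 - p) / (1 - p))%:E); last by rewrite ltry.
have /cvg_lim <- // := @nondecreasing_cvg_mu _ _ _ mu F
  mF (bigcup_measurable (fun n _ => mF n)) FN.
apply: lime_le.
  apply: ereal_nondecreasing_is_cvgn => n m nm /=.
  by apply: le_measure; rewrite ?inE; [exact: mF|exact: mF|apply/subsetPset/FN].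
apply: nearW => n /=; have /andP[n0 nb] := bn n.
apply: le_trans (@integral_powRN_le _ _ n0 nb).
rewrite mu_plE; apply: ge0_le_integral => //.
- exact: mF.
- by move=> x _; rewrite lee_fin mu_density_ge0.
- exact: measurable_EFin_mu_density.
- by apply/measurable_EFinP; apply: measurable_funTS; exact: measurable_powR.
- move=> x; rewrite /F/= in_itv/= => /andP[nx _]; have x0 := lt_le_trans n0 nx.
  rewrite lee_fin mu_densityE ?(ltW x0)// ler_piMr ?powR_ge0//.
  by rewrite -expR0 ler_expR mulNr oppr_le0 mulr_ge0 ?(ltW x0).
Qed.

Lemma PhiE b : mu `[0%R, b] = (Phi b)%:E.
Proof. by rewrite /Defs.Phi fineK// ge0_fin_numE// mu_pl_itv_lty. Qed.

Lemma mu_pl_itvoc (a b : R) : 0 <= a -> a <= b ->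
  mu `]a, b] = (Phi b - Phi a)%:E.
Proof.
move=> a0 ab.
have muab : mu `]a, b] \is a fin_num.
  rewrite ge0_fin_numE//; apply: le_lt_trans (mu_pl_itv_lty b).
  apply: le_measure; rewrite ?inE// => x /=.
  by rewrite !in_itv/= => /andP[/ltW/(le_trans a0)-> ->].
have : mu `[0%R, b] = (mu `[0%R, a] + mu `]a, b])%E.
  rewrite -measureU//.
    by rewrite -itv_bndbnd_setU// bnd_simp.
  by rewrite -subset0 => x/= []; rewrite !in_itv/=; lra.
by rewrite !PhiE -(fineK muab) -EFinD => -[->]; rewrite addrC addKr.
Qed.

Lemma Phi_lt (a b : R) : 0 <= a -> a < b -> Phi a < Phi b.
Proof.
move=> a0 ab; rewrite -subr_gt0 -lte_fin -mu_pl_itvoc ?(ltW ab)//.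
apply: lt_le_trans (@lebesgue_le_mu_pl b _ _ _) => //.
  rewrite lebesgue_measure_itv/= lte_fin ab -EFinB -EFinM lte_fin.
  by rewrite mulr_gt0 ?subr_gt0// mu_density_gt0// (le_lt_trans a0).
by move=> x /=; rewrite !in_itv/= => /andP[ax ->]; rewrite (le_lt_trans a0).
Qed.

Lemma Phi_le (a b : R) : 0 <= a -> a <= b -> Phi a <= Phi b.
Proof. by move=> a0; rewrite le_eqVlt => /predU1P[->//|/(Phi_lt _ _ a0)/ltW]. Qed.

Lemma Phi_inj : {in `[0, +oo[ &, injective Phi}.
Proof.
move=> x y; rewrite !in_itv/= !andbT => x0 y0 xy.
have [/(Phi_lt _ _ x0)|/(Phi_lt _ _ y0)|//] := ltgtP x y; by rewrite xy ltxx.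
Qed.

Lemma Phi0 : Phi 0 = 0.
Proof. by rewrite /Defs.Phi set_itv1 mu_pl_set1. Qed.

Lemma Phi_gt0 b : 0 < b -> 0 < Phi b.
Proof. by move=> b0; rewrite -Phi0 Phi_lt. Qed.

Lemma Phi_continuous (b : R) : 0 <= b -> {within `[0, b], continuous Phi}.
Proof.
move=> b0; apply: (@parameterized_integral_continuous _ 0 b rho) => //.
apply/integrableP; split; first exact: measurable_EFin_mu_density.
rewrite (le_lt_trans _ (mu_pl_itv_lty b))// mu_plE.
under eq_integral do rewrite /= ger0_norm ?mu_density_ge0//.
by [].
Qed.

Lemma Phi_lt_total (b : R) : 0 <= b -> ((Phi b)%:E < mu `[0%R, +oo[)%E.
Proof.
move=> b0; apply: (@lt_le_trans _ _ (Phi (b + 1))%:E).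
  by rewrite lte_fin Phi_lt// ltrDl.
rewrite -PhiE; apply: le_measure; rewrite ?inE// => x /=; rewrite !in_itv/= andbT.
by case/andP.
Qed.

(** Intermediate values: [Phi] is continuous, [Phi 0 = 0], and [Phi n] tends to
    the total mass. *)
Lemma Phi_surj (v : R) : 0 <= v -> (v%:E < mu `[0%R, +oo[)%E ->
  exists2 t, 0 <= t & Phi t = v.
Proof.
move=> v0 vM; pose F n := [set` `[0, n%:R]] : set R.
have UF : \bigcup_n F n = `[0, +oo[%classic.
  apply/seteqP; split=> x /=.
    by move=> [n _]; rewrite /F/= !in_itv/= andbT => /andP[].
  rewrite in_itv/= andbT => x0; exists (Num.truncn x).+1 => //.
  by rewrite /F/= in_itv/= x0 ltW ?truncnS_gt.
have mF n : measurable (F n) by exact: measurable_itv.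
have FN : nondecreasing_seq F.
  move=> n m nm; apply/subsetPset => x; rewrite /F/= !in_itv/= => /andP[->/= xn].
  by rewrite (le_trans xn)// ler_nat.
have [n vn] : exists n, v <= Phi n%:R.
  apply/not_existsP => H; move: vM; rewrite -UF ltNge => /negP; apply.
  have /cvg_lim <- // := @nondecreasing_cvg_mu _ _ _ mu F
    mF (bigcup_measurable (fun n _ => mF n)) FN.
  apply: lime_le.
    apply: ereal_nondecreasing_is_cvgn => k m nm /=.
    by apply: le_measure; rewrite ?inE; [exact: mF|exact: mF|apply/subsetPset/FN].
  apply: nearW => n /=; rewrite PhiE lee_fin ltW// ltNge; exact/negP/H.
have Pn : Phi 0 <= Phi n%:R by rewrite Phi0 (le_trans v0).
have v_bounds : Num.min (Phi 0) (Phi n%:R) <= v <= Num.max (Phi 0) (Phi n%:R).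
  by rewrite min_l// max_r// Phi0 v0.
have [t] := IVT (ler0n _ n) (Phi_continuous n%:R (ler0n _ n)) v_bounds.
by rewrite in_itv/= => /andP[t0 _] <-; exists t.
Qed.

Lemma Phi_invK (t : R) : 0 <= t -> Phi_inv p lambda (Phi t) = t%:E.
Proof.
move=> t0; rewrite /Phi_inv lt_eqF ?Phi_lt_total//; congr (_%:E).
apply: pinvKV; last by rewrite inE/= in_itv/= t0.
by move=> x y; rewrite !inE; exact: Phi_inj.
Qed.

(** * The mean of a convex function over an interval from the origin *)

(** The density is at least [rho m] on [(0, m]] and at most [rho m] on
    [(m, 2 m]], so both halves compare with [rho m] times Lebesgue measure, for
    which they cancel by symmetry about [m]. *)
Lemma integral_centered_le0 (m : R) : 0 < m ->
  \int[mu]_(t in `[0, m + m]) (t - m) <= 0.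
Proof.
move=> m0; have mm : m <= m + m by rewrite lerDl ltW.
have mf (D : set R) : measurable D -> measurable_fun D (fun t => t - m).
  by move=> mD; apply: measurable_funB.
have f_int : mu.-integrable `[0, m + m] (EFin \o (fun t => t - m)).
  apply: (@integrable_le_cst _ _ _ _ _ _ m) => //.
  - exact: mu_pl_itv_lty.
  - exact: mf.
  - by move=> t/=; rewrite in_itv/= ler_norml; lra.
have rho0 : 0 <= rho m by exact: mu_density_ge0.
have right_part :
    (\int[mu]_(t in `]m, (m + m)%R]) (t - m)%:E <= (rho m * (m ^+ 2 / 2))%:E)%E.
  have mg (D : set R) : measurable D -> measurable_fun D (fun t => (t - m)%:E).
    by move=> mD; apply/measurable_EFinP; exact: mf.
  apply: (@le_trans _ _ ((rho m)%:E *
      \int[leb]_(t in `]m, (m + m)%R]) (t - m)%:E)%E).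
    rewrite -ge0_integral_lebesgue_on//; last 2 first.
    - exact: mg.
    - by move=> t/=; rewrite in_itv/= lee_fin subr_ge0 => /andP[/ltW].
    apply: ge0_integral_le_scale => //.
    - by move=> t/=; rewrite in_itv/= lee_fin subr_ge0 => /andP[/ltW].
    - exact: mg.
    - move=> A mA Am; apply: mu_pl_le_lebesgue => // x /Am/=.
      by rewrite !in_itv/= andbT => /andP[/ltW].
  rewrite integral_itv_obnd_cbnd; last exact: mg.
  under eq_integral do rewrite -[_ - m]mul1r.
  rewrite integral_affine ?ltrDl// -EFinM lee_fin ler_wpM2l//.
  by rewrite le_eqVlt; apply/orP; left; apply/eqP; field.
have left_part :
    ((rho m * (m ^+ 2 / 2))%:E <= \int[mu]_(t in `[0%R, m]) (- (t - m))%:E)%E.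
  have mg (D : set R) : measurable D ->
      measurable_fun D (fun t => (- (t - m))%:E).
    by move=> mD; apply/measurable_EFinP; apply: measurableT_comp => //;
      exact: mf.
  (* The point 0 is discarded since the density, computed with [0 `^ (- p) = 0]
     when [p != 0], need not be decreasing there. *)
  apply: (@le_trans _ _ (\int[mu]_(t in `]0%R, m]) (- (t - m))%:E)%E); last first.
    apply: ge0_subset_integral => //.
    - exact: mg.
    - by move=> t/=; rewrite in_itv/= lee_fin; lra.
    - by move=> t/=; rewrite !in_itv/= => /andP[/ltW-> ->].
  apply: (@le_trans _ _ ((rho m)%:E *
      \int[leb]_(t in `]0%R, m]) (- (t - m))%:E)%E); last first.
    rewrite -ge0_integral_lebesgue_on//; last 2 first.
    - exact: mg.
    - by move=> t/=; rewrite in_itv/= lee_fin; lra.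
    apply: ge0_integral_ge_scale => //.
    - by move=> t/=; rewrite in_itv/= lee_fin; lra.
    - exact: mg.
    - by move=> A mA Am; apply: lebesgue_le_mu_pl.
  rewrite integral_itv_obnd_cbnd; last exact: mg.
  under eq_integral do rewrite -[- (_ - m)]mulN1r.
  rewrite integral_affine// -EFinM lee_fin ler_wpM2l//.
  by rewrite le_eqVlt; apply/orP; left; apply/eqP; field.
have I_l : `[0, m] `<=` (`[0, m + m] : set R).
  by move=> t /=; rewrite !in_itv/=; lra.
have I_r : `]m, m + m] `<=` (`[0, m + m] : set R).
  by move=> t /=; rewrite !in_itv/=; lra.
have fl_int : mu.-integrable `[0, m] (EFin \o (fun t => t - m)).
  exact: integrableS f_int.
have fr_int : mu.-integrable `]m, m + m] (EFin \o (fun t => t - m)).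
  exact: integrableS f_int.
have -> : `[0, m + m]%classic = `[0, m] `|` `]m, m + m].
  by rewrite -itv_bndbnd_setU// bnd_simp ltW.
rewrite Rintegral_setU//; last 2 first.
- by rewrite -itv_bndbnd_setU// bnd_simp ltW.
- by apply/disj_setPS => t/= []; rewrite !in_itv/=; lra.
have Rl : rho m * (m ^+ 2 / 2) <= - \int[mu]_(t in `[0, m]) (t - m).
  rewrite -lee_fin EFinN /Rintegral fineK ?integrable_fin_num//.
  by rewrite -integralN; [exact: left_part|exact: integrable_add_def].
have Rr : \int[mu]_(t in `]m, m + m]) (t - m) <= rho m * (m ^+ 2 / 2).
  by rewrite -lee_fin /Rintegral fineK ?integrable_fin_num.
by rewrite -lerBrDl sub0r (le_trans Rr).
Qed.

(** The Hermite-Hadamard bound by the mean of the end values: the chord of [N]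
    has nonnegative slope, and the barycentre of [[0, d]] is left of [d / 2]. *)
Lemma integral_convex_le (N : R -> R) (d : R) :
  convex_function (`[0, +oo[ : set R^o) N -> 0 < d -> N 0 <= N d ->
  mu.-integrable `[0, d] (EFin \o N) ->
  \int[mu]_(t in `[0, d]) N t <= Phi d * (N 0 + N d) / 2.
Proof.
move=> N_convex d0 N0d N_int; have d20 : 0 < d / 2 by rewrite divr_gt0.
have dE : d = d / 2 + d / 2 by field.
pose slope := (N d - N 0) / d; pose mean := (N 0 + N d) / 2.
have mud : (mu `[0%R, d] < +oo)%E by exact: mu_pl_itv_lty.
have t_int : mu.-integrable `[0, d] (EFin \o (fun t => t - d / 2)).
  apply: (@integrable_le_cst _ _ _ _ _ _ d) => //.
  - exact: measurable_funB.
  - by move=> t/=; rewrite in_itv/= ler_norml; lra.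
have c_int : mu.-integrable `[0, d] (EFin \o cst mean).
  by apply: (@integrable_le_cst _ _ _ _ _ _ `|mean|).
have st_int : mu.-integrable `[0, d] (EFin \o (fun t => slope * (t - d / 2))).
  by apply: (@integrableZl _ _ _ _ _ _ slope (EFin \o (fun t => t - d / 2))).
have : \int[mu]_(t in `[0, d]) N t <=
    \int[mu]_(t in `[0, d]) (mean + slope * (t - d / 2)).
  apply: le_Rintegral => //.
    exact: (@integrableD _ _ _ _ _ _ (EFin \o cst mean)
      (EFin \o (fun t => slope * (t - d / 2)))).
  move=> t; rewrite /= in_itv/= => /(convex_le_chord _ _ _ _ N_convex d0).
  move=> /le_trans; apply; rewrite le_eqVlt; apply/orP; left; apply/eqP.
  by rewrite /mean /slope; field; rewrite gt_eqF.
rewrite RintegralD// RintegralZl// Rintegral_cst// => /le_trans; apply.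
rewrite -[fine _]/(Phi d) -lerBrDl (@le_trans _ _ 0)//; last first.
  by rewrite /mean subr_ge0 le_eqVlt; apply/orP; left; apply/eqP; field.
rewrite mulr_ge0_le0//.
  by rewrite divr_ge0 ?subr_ge0 ?(ltW d0).
by rewrite {1}dE; apply: integral_centered_le0.
Qed.
(** * The inequality and its equality case *)

Section fixed_f.
Variable f : R -> R.
Hypothesis f_decr : {in `[0, +oo[ &, {homo f : x y /~ x <= y}}.
Hypothesis f_int : mu.-integrable `[0, +oo[ (EFin \o f).

(** On [[0, t]] the mean of [f] is at most its mean on [[0, h]], as [f <= f h]
    beyond [h]; after [t], [f <= f t]. *)
Lemma integral_le_mean_tail (M h t : R) : mu `[0%R, +oo[ = M%:E -> 0 < h -> h <= t ->
  \int[mu]_(s in `[0, +oo[) f s <=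
  (\int[mu]_(s in `[0, h]) f s) / Phi h * Phi t + f t * (M - Phi t).
Proof.
move=> muM h0 ht; have t0 := lt_le_trans h0 ht.
have H0 : 0 < Phi h by exact: Phi_gt0.
have tE : mu `]t, +oo[ = (M - Phi t)%:E.
  have : mu `[0%R, +oo[ = (mu `[0%R, t] + mu `]t, +oo[)%E.
    rewrite -measureU//.
      by rewrite -itv_bndbnd_setU// bnd_simp ltW.
    by rewrite -subset0 => x/= []; rewrite !in_itv/=; lra.
  rewrite muM PhiE//.
  case: (mu `]t, +oo[) => [r|//|//].
  by rewrite -EFinD => -[->]; rewrite addrC addKr.
have htE : mu `]h, t] = (Phi t - Phi h)%:E by apply: mu_pl_itvoc => //; exact: ltW.
have muh : (mu `[0%R, h] < +oo)%E by exact: mu_pl_itv_lty.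
have split1 : \int[mu]_(s in `[0, +oo[) f s =
    \int[mu]_(s in `[0, t]) f s + \int[mu]_(s in `]t, +oo[) f s.
  rewrite -Rintegral_setU//.
  - by rewrite -itv_bndbnd_setU// bnd_simp ltW.
  - by rewrite -itv_bndbnd_setU// bnd_simp ltW.
  - by apply/disj_setPS => x/= []; rewrite !in_itv/=; lra.
have split2 : \int[mu]_(s in `[0, t]) f s =
    \int[mu]_(s in `[0, h]) f s + \int[mu]_(s in `]h, t]) f s.
  rewrite -Rintegral_setU//.
  - by rewrite -itv_bndbnd_setU// bnd_simp ltW.
  - rewrite -itv_bndbnd_setU// ?bnd_simp ?ltW//.
    by apply: integrableS f_int => // x/=; rewrite !in_itv/= andbT => /andP[].
  - by apply/disj_setPS => x/= []; rewrite !in_itv/=; lra.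
have tail : \int[mu]_(s in `]t, +oo[) f s <= f t * (M - Phi t).
  have <- : fine (mu `]t, +oo[) = M - Phi t by rewrite tE.
  apply: integral_decr_le => //; first exact: ltW.
  - by move=> x/=; rewrite !in_itv/= !andbT => /ltW.
  - by rewrite -[X in (X < _)%E]/(mu `]t, +oo[) tE ltry.
have mid : \int[mu]_(s in `]h, t]) f s <= f h * (Phi t - Phi h).
  have <- : fine (mu `]h, t]) = Phi t - Phi h by rewrite htE.
  apply: integral_decr_le => //; first exact: ltW.
  - by move=> x/=; rewrite !in_itv/= andbT => /andP[/ltW].
  - by rewrite -[X in (X < _)%E]/(mu `]h, t]) htE ltry.
have start : f h * Phi h <= \int[mu]_(s in `[0, h]) f s.
  by apply: integral_decr_ge => //; exact: ltW.
have c_ge : f h <= (\int[mu]_(s in `[0, h]) f s) / Phi h by rewrite ler_pdivlMr.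
rewrite split1 split2 lerD// -lerBrDl (le_trans mid)//.
set c := _ / Phi h in c_ge *.
have -> : \int[mu]_(s in `[0, h]) f s = c * Phi h by rewrite divfK ?gt_eqF.
rewrite -mulrBr ler_wpM2r// subr_ge0.
by apply: Phi_le => //; exact: ltW.
Qed.

End fixed_f.

Variable N : R -> R.
Hypotheses (N_ge0 : {in `[0, +oo[, forall t, 0 <= N t})
  (N_incr : {in `[0, +oo[ &, {homo N : x y / x <= y}})
  (N_convex : convex_function (`[0, +oo[ : set R^o) N).

Lemma moment_ge_indicator (f : R -> R) (h : R) :
  {in `[0, +oo[, forall t, 0 <= f t} ->
  {in `[0, +oo[ &, {homo f : x y /~ x <= y}} ->
  mu.-integrable `[0, +oo[ (EFin \o f) ->
  0 < h ->
  let V := \int[mu]_(t in `[0, +oo[) f t in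
  let u := \int[mu]_(t in `[0, h]) f t in
  u <= 2^-1 * V ->
  ((u / Phi h)%:E *
     \int[mu]_(t in [set t : R | (0 <= t)%R /\
        t%:E <= Phi_inv p lambda (V / u * Phi h)%R]) (N t)%:E
   <= \int[mu]_(t in `[0%R, +oo[) (N t * f t)%:E)%E.
Proof.
move=> f_ge0 f_decr f_int h0 V u uV.
have Nf_ge0 t : `[0, +oo[%classic t -> 0 <= N t * f t.
  by move=> t0; rewrite mulr_ge0 ?N_ge0 ?f_ge0.
have mN : measurable_fun (`[0, +oo[ : set R) N by exact: measurable_fun_homo_itvcy.
have mf : measurable_fun (`[0, +oo[ : set R) f.
  by apply/measurable_EFinP; exact: measurable_int f_int.
have mNf : measurable_fun (`[0, +oo[ : set R) (EFin \o (fun t => N t * f t)).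
  by apply/measurable_EFinP; exact: measurable_funM.
have H0 : 0 < Phi h by exact: Phi_gt0.
have u_ge0 : 0 <= u.
  by apply: Rintegral_ge0 => x/=; rewrite in_itv/= => /andP[x0 _];
    rewrite f_ge0// in_itv/= x0.
move: u_ge0; rewrite le_eqVlt => /predU1P[<-|u0].
  rewrite mul0r mul0e; apply: integral_ge0 => t t0.
  by rewrite lee_fin Nf_ge0.
pose c := u / Phi h; have c0 : 0 < c by rewrite divr_gt0.
pose v := V / u * Phi h.
have VE : V = c * v by rewrite /c /v; field; rewrite !gt_eqF.
have vM : (v%:E <= mu `[0%R, +oo[)%E.
  case M_E : (mu `[0%R, +oo[) => [M| |].
  - have hM : Phi h < M.
      by rewrite -lte_fin -M_E; apply: Phi_lt_total => //; exact: ltW.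
    have tail := integral_le_mean_tail f f_decr f_int M h h M_E h0 (lexx h).
    have fh : f h <= c.
      rewrite ler_pdivlMr//; apply: integral_decr_ge => //; first exact: ltW.
      exact: mu_pl_itv_lty.
    rewrite lee_fin -(ler_pM2l c0) -VE (le_trans tail)//.
    rewrite -[_ / Phi h]/c -lerBrDl -mulrBr ler_wpM2r// subr_ge0.
    exact: ltW.
  - by rewrite leey.
  - have : (0 <= mu `[0%R, +oo[)%E by exact: measure_ge0.
    by rewrite M_E.
rewrite -/c -/v; move: vM; rewrite le_eqVlt => /predU1P[vM|vM].
  (* If [v] is the total mass, [integral_le_mean_tail] read at [s >= h] gives
     [c * (v - Phi s) <= f s * (v - Phi s)], with [Phi s < v]. *)
  have c_le_f t : 0 <= t -> c <= f t.
    suff c_le_f_tail s : h <= s -> c <= f s.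
      move=> t0; have [ht|/ltW th] := leP h t; first exact: c_le_f_tail.
      apply: (le_trans (c_le_f_tail h (lexx h))).
      by rewrite f_decr ?in_itv/= ?t0 ?(ltW h0).
    move=> hs; have s0 : 0 <= s by rewrite (le_trans (ltW h0)).
    have sv : Phi s < v by rewrite -lte_fin vM; exact: Phi_lt_total.
    have := integral_le_mean_tail f f_decr f_int v h s (esym vM) h0 hs.
    rewrite -/V VE -[_ / Phi h]/c -lerBlDl -mulrBr ler_pM2r// subr_gt0//.
  have -> : [set t : R | (0 <= t)%R /\ (t%:E <= Phi_inv p lambda v)%E] =
      `[0, +oo[%classic.
    rewrite /Phi_inv vM eqxx; apply/seteqP; split => t /=.
      by rewrite in_itv/= andbT => -[].
    by rewrite in_itv/= andbT => ->; rewrite leey.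
  rewrite -ge0_integralZl//.
  - apply: ge0_le_integral => //.
    + by move=> t t0; rewrite -EFinM lee_fin mulr_ge0 ?N_ge0// ltW.
    + by apply: measurable_funeM; exact/measurable_EFinP.
    + move=> t t0; rewrite -EFinM lee_fin mulrC ler_wpM2l ?N_ge0// c_le_f//.
      by move: t0; rewrite /= in_itv/= andbT.
  - exact/measurable_EFinP.
  - by rewrite lee_fin (ltW c0).
have v0 : 0 <= v.
  by rewrite -(pmulr_rge0 _ c0) -VE (le_trans (ltW u0))// (le_trans uV)//; lra.
have [d d0 dE] := Phi_surj v v0 vM.
have -> : [set t : R | (0 <= t)%R /\ (t%:E <= Phi_inv p lambda v)%E] =
    `[0, d]%classic.
  rewrite -dE Phi_invK//; apply/seteqP; split => t /=; rewrite in_itv/= lee_fin.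
    by case=> -> ->.
  by case/andP.
have [Nf_oo|Nf_fin] := leP +oo%E (\int[mu]_(t in `[0%R, +oo[) (N t * f t)%:E)%E.
  by apply: le_trans Nf_oo; rewrite leey.
have Nf_int : mu.-integrable `[0, +oo[ (EFin \o (fun t => N t * f t)).
  apply/integrableP; split => //.
  under eq_integral => t /set_mem t0 do rewrite /= ger0_norm ?Nf_ge0//.
  done.
(* This is the hypothesis [u <= V / 2]. *)
have D_ge : 2 * Phi h <= Phi d.
  rewrite dE -(ler_pM2l c0) -VE /c; rewrite mulrCA divfK ?gt_eqF//; lra.
have hd : h <= d.
  rewrite leNgt; apply/negP => dh; have := Phi_lt d h d0 dh; lra.
have dgt0 := lt_le_trans h0 hd.
have mud : (mu `[0%R, d] < +oo)%E by exact: mu_pl_itv_lty.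
have N_int : mu.-integrable `[0, d] (EFin \o N) by exact: integrable_homo_itv.
have N0d : N 0 <= N d by rewrite N_incr ?in_itv/= ?lexx ?d0.
pose I := \int[mu]_(t in `[0, d]) N t.
have I_le : I <= Phi d * (N 0 + N d) / 2 by exact: integral_convex_le.
pose beta := (N d * Phi d - I) / Phi h.
have betaE : beta * Phi h = N d * Phi d - I by rewrite divfK ?gt_eqF.
(* [2 * H <= Phi d] and the bound on the mean of [N]. *)
have key : (N d - N 0) * Phi h <= N d * Phi d - I.
  rewrite -subr_ge0 in N0d; rewrite -subr_ge0 in D_ge.
  have := mulr_ge0 N0d D_ge; lra.
have N0_beta : N d <= N 0 + beta.
  by rewrite -lerBlDl ler_pdivlMr.
have := @balanced_weight_integral_ge _ mu f N h d beta (ltW h0) hd f_ge0 f_decr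
  N_ge0 N_incr mud f_int Nf_int N0_beta betaE.
rewrite -/V -/u => main.
rewrite -(@fineK _ (\int[mu]_(t in `[0%R, d]) (N t)%:E)%E) ?integrable_fin_num//.
rewrite -(@fineK _ (\int[mu]_(t in `[0%R, +oo[) (N t * f t)%:E)%E) ?integrable_fin_num//.
rewrite -EFinM lee_fin (le_trans _ main)// -[fine _]/I.
have uE : u = c * Phi h by rewrite /c divfK ?gt_eqF.
rewrite VE -dE uE [beta * _]mulrCA betaE.
by rewrite le_eqVlt; apply/orP; left; apply/eqP; ring.
Qed.

Lemma moment_indicator_eq (c d h : R) : 0 < c -> 0 < d -> 0 < h ->
  let f := fun t : R => c * \1_(`[0, d] : set R) t in
  let V := \int[mu]_(t in `[0, +oo[) f t in
  let u := \int[mu]_(t in `[0, h]) f t in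
  u <= 2^-1 * V ->
  (\int[mu]_(t in `[0%R, +oo[) (N t * f t)%:E =
   (u / Phi h)%:E *
     \int[mu]_(t in [set t : R | (0 <= t)%R /\
        t%:E <= Phi_inv p lambda (V / u * Phi h)%R]) (N t)%:E)%E.
Proof.
move=> c0 d0 h0 f V u uV.
have VE : V = c * Phi d.
  rewrite /V /f Rintegral_scaled_indic ?(ltW c0)//; congr (c * fine (mu _)).
  by apply/setIidPl => x/=; rewrite !in_itv/= andbT => /andP[].
have Vpos : 0 < V by rewrite VE mulr_gt0// Phi_gt0.
have hd : h < d.
  rewrite ltNge; apply/negP => dh.
  (* If [d <= h] then [u = V], against [u <= V / 2]. *)
  suff uE : u = V by move: uV; rewrite uE; lra.
  rewrite VE /u /f Rintegral_scaled_indic ?(ltW c0)//; congr (c * fine (mu _)).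
  apply/setIidPl => x/=; rewrite !in_itv/= => /andP[-> xd].
  exact: le_trans dh.
have H0 : 0 < Phi h by exact: Phi_gt0.
have uE : u = c * Phi h.
  rewrite /u /f Rintegral_scaled_indic ?(ltW c0)//; congr (c * fine (mu _)).
  apply/setIidPr => x/=; rewrite !in_itv/= => /andP[-> xh].
  exact: (le_trans xh (ltW hd)).
have -> : V / u * Phi h = Phi d.
  by rewrite VE uE; field; rewrite !gt_eqF.
have -> : u / Phi h = c by rewrite uE mulfK ?gt_eqF.
have -> : [set t : R | (0 <= t)%R /\ (t%:E <= Phi_inv p lambda (Phi d))%E] =
    `[0, d]%classic.
  rewrite Phi_invK ?(ltW d0)//; apply/seteqP; split => t /=; rewrite in_itv/= lee_fin.
    by case=> -> ->.
  by case/andP.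
have dI : `[0, d] `<=` (`[0, +oo[ : set R).
  by move=> x/=; rewrite !in_itv/= andbT => /andP[].
rewrite -ge0_integralZl//; last 3 first.
- apply/measurable_EFinP.
  exact: measurable_funS (measurable_fun_homo_itvcy _ _ N_incr).
- by move=> t t0; rewrite lee_fin N_ge0//; exact: dI.
- by rewrite lee_fin ltW.
rewrite -[in RHS](setIidr dI) integral_mkcondr; apply: eq_integral => t _.
rewrite patchE /f indicE; case: ifPn => _ /=.
  by rewrite mulr1 mulrC EFinM.
by rewrite !mulr0.
Qed.

End mu_pl_theory.

Theorem theorem3p4 (R : realType) (p lambda : R)
    (hp0 : 0 <= p) (hp1 : p < 1) (hlambda : 0 <= lambda)
    (N : R -> R)
    (N_ge0 : {in `[0, +oo[, forall t, 0 <= N t})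
    (N_incr : {in `[0, +oo[ &, {homo N : x y / x <= y}})
    (N_convex : convex_function (`[0, +oo[ : set R^o) N) :
  (forall f : R -> R,
     {in `[0, +oo[, forall t, 0 <= f t} ->
     {in `[0, +oo[ &, {homo f : x y /~ x <= y}} ->
     log_concave f ->
     (mu_pl p lambda).-integrable `[0, +oo[ (EFin \o f) ->
     let V := \int[mu_pl p lambda]_(t in `[0, +oo[) f t in
     0 < V ->
     forall h : R, 0 < h ->
     let u := \int[mu_pl p lambda]_(t in `[0, h]) f t in
     u <= 2^-1 * V ->
     ((u / Phi p lambda h)%:E *
        \int[mu_pl p lambda]_(t in [set t : R | (0 <= t)%R /\
           t%:E <= Phi_inv p lambda (V / u * Phi p lambda h)%R]) (N t)%:E
      <= \int[mu_pl p lambda]_(t in `[0%R, +oo[) (N t * f t)%:E)%E)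
  /\
  (forall c d h : R, 0 < c -> 0 < d -> 0 < h ->
     let f := fun t : R => c * \1_(`[0, d] : set R) t in
     let V := \int[mu_pl p lambda]_(t in `[0, +oo[) f t in
     let u := \int[mu_pl p lambda]_(t in `[0, h]) f t in
     u <= 2^-1 * V ->
     (\int[mu_pl p lambda]_(t in `[0%R, +oo[) (N t * f t)%:E =
      (u / Phi p lambda h)%:E *
        \int[mu_pl p lambda]_(t in [set t : R | (0 <= t)%R /\
           t%:E <= Phi_inv p lambda (V / u * Phi p lambda h)%R]) (N t)%:E)%E).
Proof.
split => [f f_ge0 f_decr _ f_int V _ h h0 u uV|c d h c0 d0 h0 f V u uV].
  exact: moment_ge_indicator.
exact: moment_indicator_eq.
Qed.
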